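(* Let $p$ be an odd prime with $p-1$ not divisible by $4$. Let $G=\{a\in\mathbb{F}_{p^4}: a^{p^2}+a=0\}$ (an additive group of order $p^2$), let $G_1,\dots,G_{p+1}$ be its $p+1$ subgroups of order $p$ (the additive subgroups $\{0,a,2a,\dots,(p-1)a\}$ generated by non-zero $a\in G$), and let $\phi_1:\mathbb{F}_{p^4}\to\mathbb{F}_{p^4}$, $a\mapsto a^p$. Then no subgroup $G_i$ is stable under $\phi_1$. Moreover, the set of the $p+1$ subgroups $G_i$ is the union of $\frac{p+1}{2}$ subsets consisting of two distinct elements $\{G_i,G_j\}$ such that $\phi_1(G_i)=G_j$ and $\phi_1(G_j)=G_i$. *)

(* Defs.v *)
From HB Require Import structures.
From mathcomp Require Import all_boot all_order all_algebra all_fingroup.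
Set Implicit Arguments.
Unset Strict Implicit.
Unset Printing Implicit Defensive.
Import GRing.Theory.
Local Open Scope ring_scope.

Definition frob (F : finFieldType) (p : nat) (a : F) : F := a ^+ p.

Definition Gset (F : finFieldType) (p : nat) : {set F} :=
  [set a | a ^+ (p ^ 2) + a == 0].

(* A [finFieldType] is a [finGroupType] for addition, so [{group F}] is the
   type of additive subgroups of [F]. *)
Definition order_p_subgroups (F : finFieldType) (p : nat) :
    {set {group F}} :=
  [set H : {group F} | (H \subset Gset F p) && (#|H| == p)].

Fact zmod_group (F : finFieldType) (x y : F) : (x * y)%g = x + y.
Proof. by []. Qed.

(* Main.v *)
(** Let [q = p^2].  Since [2 != 0] and every [x] satisfies [x ^+ q ^+ q = x],
    the map [x |-> (x^q - x, x^q + x)] embeds [F] into [G * F_q], so [G] has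
    order exactly [q] and, being elementary abelian of rank 2, has [p + 1]
    subgroups of order [p].  The square of the Frobenius map is [-1] on [G], so
    it induces an involution of these subgroups.  If the line generated by [a]
    were stable, then [a^p = k a] with [k] in the prime field, hence
    [- a = k^2 a], contradicting that [-1] is not a square modulo [p]. *)

Require Import Defs.
From mathcomp Require Import all_boot all_order all_algebra all_fingroup.
From mathcomp Require Import all_solvable all_field ring.
Import GRing.Theory FinRing.Theory.
Local Open Scope ring_scope.

(** Any member [z] of a block recovers it as [[set z; f z]], because [f] is an involution on [S]; so
    two blocks that meet coincide. A fixed point would give a singleton block. *)
Lemma involution_partition (T : finType) (S : {set T}) (f : T -> T) :
  {in S, forall x, f x \in S} -> {in S, forall x, f (f x) = x} ->
  partition [set [set x; f x] | x in S] S.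
Proof.
move=> fS ffK; apply/and3P; split.
- apply/eqP/setP=> y; apply/bigcupP/idP.
    by case=> _ /imsetP[x Sx ->]; rewrite !inE => /orP[]/eqP-> //; apply: fS.
  by move=> Sy; exists [set y; f y]; [apply: imset_f | rewrite !inE eqxx].
- apply/trivIsetP=> _ _ /imsetP[x Sx ->] /imsetP[y Sy ->].
  apply: contraR => /pred0Pn[z /=]; rewrite !inE => /andP[].
  have pairE t : t \in S -> z = t \/ z = f t -> [set t; f t] = [set z; f z].
    by move=> St [->//|->]; rewrite ffK // setUC.
  by move=> /pred2P/(pairE _ Sx)-> /pred2P/(pairE _ Sy)->.
- by apply/imsetP=> -[x _ /setP/(_ x)]; rewrite !inE eqxx.
Qed.

Lemma two_neq0_pchar (R : nzRingType) (p : nat) :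
  p \in [pchar R] -> odd p -> 2%:R != 0 :> R.
Proof.
move=> charR p_odd; rewrite -(dvdn_pcharf charR).
apply: contraL p_odd => /(prime_nt_dvdP _)-> //.
by case/andP: charR => /prime_gt1; case: p => [|[]].
Qed.

(** As [1 < n], the term ['X^n] dominates and the polynomial has degree exactly [n]. The cases
    [c = 1] and [c = -1] bound $G$ and the fixed points of $x \mapsto x^q$. *)
Lemma card_roots_Xn_linear (R : finIdomainType) (n : nat) (c : R) :
  (1 < n)%N -> (#|[set x : R | x ^+ n + c * x == 0]%R| <= n)%N.
Proof.
move=> n_gt1; have szc : (size (c *: 'X : {poly R}) < size ('X^n : {poly R}))%N.
  by rewrite size_polyXn ltnS (leq_trans (size_scale_leq _ _)) // size_polyX.
have sz : size ('X^n + c *: 'X : {poly R}) = n.+1.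
  by rewrite size_polyDl // size_polyXn.
rewrite -ltnS -sz cardE; apply: max_poly_roots; last exact: enum_uniq.
  by rewrite -size_poly_gt0 sz.
by apply/allP=> x; rewrite mem_enum inE rootE !hornerE.
Qed.

Section OddCharacteristic.

Context {p : nat} {F : finFieldType}.
Hypotheses (charF : p \in [pchar F]) (p_odd : odd p).

Let p_prime : prime p. Proof. by case/andP: charF. Qed.

Lemma frobD : {morph @frob F p : x y / x + y}.
Proof. by move=> x y; rewrite /frob exprDn_pchar // pnatE. Qed.

Lemma frobM : {in setT &, {morph @frob F p : x y / (x * y)%g}}.
Proof. by move=> x y _ _; rewrite !zmodMgE frobD. Qed.

Canonical frob_morphism := Morphism frobM.

Lemma frob_frob (x : F) : frob p (frob p x) = x ^+ (p ^ 2).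
Proof. by rewrite /frob -exprM. Qed.

Lemma frob_inj : injective (@frob F p).
Proof.
move=> x y xy; apply/eqP; rewrite -subr_eq0.
have := frobD (x - y) y; rewrite subrK xy -{1}[frob p y]add0r => /addIr/esym/eqP.
by rewrite expf_eq0 => /andP[].
Qed.

Lemma frobMn (x : F) (k : nat) : frob p (x *+ k) = frob p x *+ k.
Proof.
elim: k => [|k IHk]; last by rewrite !mulrS frobD IHk.
by rewrite !mulr0n /frob expr0n; case: p p_prime.
Qed.

Lemma GsetE (a : F) : (a \in Gset F p) = (frob p (frob p a) == - a).
Proof. by rewrite inE frob_frob addr_eq0. Qed.

Lemma frob_Gset (a : F) : a \in Gset F p -> frob p a \in Gset F p.
Proof.
rewrite !GsetE => /eqP aG.
by rewrite -addr_eq0 -frobD aG addNr expf_eq0 eqxx prime_gt0.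
Qed.

Lemma Gset_group_set : group_set (Gset F p).
Proof.
apply/group_setP; split=> [|x y]; last first.
  by rewrite zmodMgE !GsetE !frobD opprD => /eqP-> /eqP->.
by rewrite zmod1gE inE expr0n addr0 expn_eq0; case: p p_prime.
Qed.

Canonical Gset_group := Group Gset_group_set.

Lemma order_p_char (a : F) : a != 0 -> #[a]%g = p.
Proof.
move=> nz_a; apply: nt_prime_order => //.
by rewrite zmodXgE zmod1gE -mulr_natr pcharf0 // mulr0.
Qed.

Lemma cycle_multiples (a : F) : a != 0 -> <[a]>%g = [set a *+ k | k : 'I_p].
Proof.
move=> nz_a; apply/setP=> x; apply/idP/imsetP.
  case/cyclePmin=> k; rewrite order_p_char // => lt_kp ->.
  by exists (Ordinal lt_kp); rewrite ?zmodXgE.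
by case=> k _ ->; rewrite -zmodXgE mem_cycle.
Qed.

Lemma order_p_subgroupsP (H : {group F}) :
  reflect (exists a, [/\ a \in Gset F p, a != 0 & H = <[a]>%g :> {set F}])
          (H \in order_p_subgroups F p).
Proof.
rewrite inE; apply: (iffP andP) => [[sHG /eqP oH] | [a [Ga nz_a ->]]]; last first.
  by rewrite cycle_subG Ga -orderE order_p_char.
have /trivgPn[a Ha nz_a] : H :!=: 1%g by rewrite -cardG_gt1 oH prime_gt1.
exists a; split=> //; first exact: (subsetP sHG).
by apply/eqP; rewrite eq_sym eqEcard cycle_subG Ha -orderE order_p_char ?oH /=.
Qed.

Lemma frob_order_p_subgroups (H : {group F}) :
  H \in order_p_subgroups F p ->
  (@frob F p @* H)%G \in order_p_subgroups F p.
Proof.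
rewrite !inE => /andP[/subsetP sHG oH]; rewrite /= morphimEsub ?subsetT //.
rewrite card_imset ?oH ?andbT; last exact: frob_inj.
by apply/subsetP=> _ /imsetP[x /sHG Gx ->]; apply: frob_Gset.
Qed.

(** Applied twice, Frobenius negates the elements of $G$, and a subgroup is closed under negation.
    One inclusion suffices, since injectivity preserves cardinality. *)
Lemma frob_involutive_subgroups (H : {group F}) :
  H \in order_p_subgroups F p -> (@frob F p @* (@frob F p @* H))%G = H.
Proof.
move=> SH; have [/subsetP sHG _] := setIdP SH.
have := frob_order_p_subgroups _ SH => SfH.
apply/val_inj/eqP; rewrite /= eqEcard !morphimEsub ?subsetT //.
rewrite !card_imset ?leqnn ?andbT; try exact: frob_inj.
apply/subsetP=> _ /imsetP[_ /imsetP[x Hx ->] ->].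
have := sHG x Hx; rewrite GsetE /= => /eqP->.
by rewrite -zmodVgE groupV.
Qed.

(** If $k^2 = -1$, then $k^{p-1}$ is $(-1)^{(p-1)/2} = -1$, the exponent being odd, but also $1$ by
    Fermat; this forces $2 = 0$. *)
Lemma sqrN1_natr (k : nat) : ~~ (4 %| p - 1)%N -> (k%:R : F) ^+ 2 != -1.
Proof.
move=> p3mod4; apply/eqP=> k2.
have odd_h : odd ((p - 1) %/ 2)%N.
  move: p3mod4; apply: contraR => even_h.
  have even_p1 : (2 %| p - 1)%N by rewrite dvdn2 oddB ?prime_gt0 // p_odd.
  by rewrite -(divnK even_p1) (@dvdn_pmul2r 2 2) // dvdn2.
have k_eq : (k%:R : F) ^+ (p - 1) = -1.
  have -> : (p - 1 = 2 * ((p - 1) %/ 2))%N.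
    by rewrite mulnC divnK // dvdn2 oddB ?prime_gt0 // p_odd.
  by rewrite exprM k2 -signr_odd odd_h.
(* Fermat's little theorem: Frobenius is additive and fixes 1, hence fixes every multiple of 1. *)
have kp : (k%:R : F) ^+ p = k%:R.
  by have := frobMn 1 k; rewrite /frob expr1n.
have nz_k : (k%:R : F) != 0.
  by apply: contra_eq_neq k2 => ->; rewrite expr0n eq_sym oppr_eq0 oner_eq0.
have k1 : (k%:R : F) ^+ (p - 1) = 1.
  by apply: (mulfI nz_k); rewrite -exprS subn1 prednK ?prime_gt0 // mulr1.
have /negP[] := two_neq0_pchar _ _ charF p_odd.
by rewrite mulr2n -[X in X + _ == _]k1 k_eq addNr.
Qed.

Lemma frob_not_stable (H : {group F}) : ~~ (4 %| p - 1)%N ->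
  H \in order_p_subgroups F p -> ~~ (@frob F p @: H \subset H).
Proof.
move=> p3mod4 /order_p_subgroupsP[a [Ga nz_a ->]].
apply/negP=> /subsetP/(_ (frob p a)).
rewrite imset_f ?cycle_id // => /(_ isT)/cycleP[k]; rewrite zmodXgE => ak.
(* From [frob p a = a *+ k], a second application gives $k^2 a = -a$; then cancel $a$. *)
move: Ga; rewrite GsetE ak frobMn ak -mulrnA -mulr_natr -mulrN1.
move=> /eqP/(mulfI nz_a)/eqP; rewrite natrM -expr2.
by apply/negP/sqrN1_natr.
Qed.

Lemma card_Gset : #|F| = (p ^ 4)%N -> #|Gset F p| = (p ^ 2)%N.
Proof.
move=> cardF; set q := (p ^ 2)%N.
have q_gt1 : (1 < q)%N by rewrite -(exp1n 2) ltn_exp2r ?prime_gt1.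
have qq (x : F) : (x ^+ q) ^+ q = x.
  by rewrite -exprM /q -expnD -cardF expf_card.
have qD (x y : F) : (x + y) ^+ q = x ^+ q + y ^+ q.
  by rewrite -!frob_frob !frobD.
have qN (x : F) : (- x) ^+ q = - x ^+ q.
  by apply/eqP; rewrite -addr_eq0 -qD addNr expr0n -[q == 0%N]leqn0 leqNgt ltnW.
pose K := [set x : F | x ^+ q + (-1) * x == 0].
have leG : (#|Gset F p| <= q)%N.
  have -> : Gset F p = [set x | x ^+ q + 1 * x == 0].
    by apply/setP=> x; rewrite !inE mul1r.
  exact: card_roots_Xn_linear.
have leK : (#|K| <= q)%N by apply: card_roots_Xn_linear.
(* For the lower bound, multiply by $q$: it is enough that $q^2 = |F| \le |G| \cdot |K| \le |G|
   \cdot q$. *)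
apply/eqP; rewrite eqn_leq leG -(leq_pmul2r (ltnW q_gt1)) /=.
pose h (x : F) := (x ^+ q - x, x ^+ q + x).
have h_inj : injective h.
  move=> x y [/eqP e1 e2]; have /eqP := e2.
  rewrite -subr_eq0 => e3; move: e1; rewrite -subr_eq0 => e1.
  (* The second component of [h] minus the first is twice the argument. *)
  have : 2%:R * (x - y) = 0.
    by rewrite -(eqP e3) -[LHS]addr0 -(eqP e1); ring.
  move/eqP; rewrite mulf_eq0 (negPf (two_neq0_pchar _ _ charF p_odd)).
  by rewrite subr_eq0 => /eqP.
have -> : (q * q = #|F|)%N by rewrite cardF -expnD.
rewrite -(card_imset F h_inj) (leq_trans _ (leq_mul (leqnn _) leK)) //.
rewrite -cardsX; apply/subset_leq_card/subsetP=> _ /imsetP[x _ ->].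
(* Since $x^{q^2} = x$, the map $x \mapsto x^q$ swaps $x$ and $x^q$: it negates their difference and
   fixes their sum. *)
rewrite !inE /= mulN1r !qD qN qq addrA subrK subrr eqxx.
by rewrite [x + _]addrC subrr eqxx.
Qed.

Lemma card_order_p_subgroups : #|F| = (p ^ 4)%N ->
  #|order_p_subgroups F p| = p.+1.
Proof.
move=> cardF; have EG : [group of Gset F p] \in 'E_p^2([set: F])%g.
  apply/pnElemP; rewrite subsetT card_Gset // pfactorK //; split=> //.
  apply/abelemP=> //; split; first exact: zmod_abelian.
  by move=> x _; rewrite zmodXgE zmod1gE -mulr_natr pcharf0 // mulr0.
(* The rank 1 elementary abelian subgroups of $G$, that is, the lines of a plane over the prime
   field, are its subgroups of order [p]. *)
rewrite -(card_p1Elem_p2Elem EG) p1ElemE //.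
by congr #|pred_of_set _|; apply/setP=> H; rewrite !inE.
Qed.

End OddCharacteristic.

Theorem theorem4p6 (p : nat) (F : finFieldType)
    (p_prime : prime p) (p_odd : odd p) (p_not1mod4 : ~~ (4 %| p - 1)%N)
    (cardF : #|F| = (p ^ 4)%N) :
  [/\ group_set (Gset F p) /\ #|Gset F p| = (p ^ 2)%N,
      #|order_p_subgroups F p| = p.+1,
      forall H : {group F}, H \in order_p_subgroups F p <->
        exists a : F, [/\ a \in Gset F p, a != 0 &
          H = [set a *+ k | k : 'I_p] :> {set F}],
      forall H : {group F}, H \in order_p_subgroups F p ->
        ~~ (@frob F p @: H \subset H) &
      exists P : {set {set {group F}}},
        [/\ #|P| = ((p + 1) %/ 2)%N,
            cover P = order_p_subgroups F p &
            forall B, B \in P -> exists Gi Gj : {group F},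
              [/\ Gi != Gj, B = [set Gi; Gj],
                  @frob F p @: Gi = Gj :> {set F} &
                  @frob F p @: Gj = Gi :> {set F}]]].
Proof.
have charF : p \in [pchar F] by apply: card_finPcharP cardF p_prime.
pose phi (H : {group F}) := (frob_morphism charF @* H)%G.
have phiE H : phi H = @frob F p @: H :> {set F} by apply/morphimEsub/subsetT.
have phiS H (SH : H \in order_p_subgroups F p) := frob_order_p_subgroups charF H SH.
have phiK H (SH : H \in order_p_subgroups F p) := frob_involutive_subgroups charF H SH.
have phi_neq H : H \in order_p_subgroups F p -> H != phi H.
  move=> SH; have := frob_not_stable charF p_odd _ p_not1mod4 SH.
  by apply: contraNneq => {2}->; rewrite phiE.
have partP := involution_partition _ _ phi phiS phiK.
split.
- by split; [apply: Gset_group_set | apply: card_Gset].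
- exact: card_order_p_subgroups.
- move=> H; split=> [/(order_p_subgroupsP charF)|] [a [Ga nz_a defH]].
    by exists a; rewrite defH (cycle_multiples charF).
  by apply/(order_p_subgroupsP charF); exists a; rewrite (cycle_multiples charF).
- by move=> H; apply: frob_not_stable.
exists [set [set H; phi H] | H in order_p_subgroups F p]; split.
(* No subgroup is fixed by [phi], so every block has exactly two elements and the count [p.+1] is
   twice the number of blocks. *)
- rewrite addn1 -(card_order_p_subgroups charF p_odd cardF).
  rewrite (card_uniform_partition (n := 2) _ partP) ?mulnK //.
  by move=> _ /imsetP[H SH ->]; rewrite cards2 phi_neq.
- by case/and3P: partP => /eqP.
move=> _ /imsetP[H SH ->]; exists H, (phi H); split; rewrite ?phi_neq -?phiE //.
by rewrite -[in RHS](phiK H SH).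
Qed.
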